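(* Let $G=(V,E)$ be a finite, simple, undirected, connected bipartite graph. Then $$\rho_c(G) \leq \rho_p(G) \leq \alpha(G) \quad\text{and}\quad ip_c(G) \leq ip_p(G) \leq \alpha(G).$$
   Context: $\alpha(G)$ is the independence number of $G$. Paths are allowed to consist of a single vertex. A path $P$ in $G$ is an induced path if the subgraph of $G$ induced by the vertex set of $P$ is exactly $P$; it is an isometric path if it is a shortest path between its endpoints in $G$. An induced (resp. isometric) path cover of $G$ is a set of induced (resp. isometric) paths such that every vertex of $G$ lies on at least one of them; an induced (resp. isometric) path partition is such a set in which every vertex lies on exactly one of the paths. $\rho_c(G)$ and $ip_c(G)$ denote the minimum cardinality of an induced path cover and of an isometric path cover of $G$; $\rho_p(G)$ and $ip_p(G)$ denote the minimum cardinality of an induced path partition and of an isometric path partition of $G$. *)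

(* Defs.v *)
From mathcomp Require Import all_boot.

Set Implicit Arguments.
Unset Strict Implicit.
Unset Printing Implicit Defensive.

Record sgraph := SGraph {
  vertex :> finType;
  edge : rel vertex;
  edge_sym : symmetric edge;
  edge_irr : irreflexive edge }.

Definition connected (G : sgraph) : Prop :=
  forall x y : G, connect (@edge G) x y.

Definition bipartite (G : sgraph) : Prop :=
  exists A : {set G}, forall x y : G, edge x y -> (x \in A) != (y \in A).

Definition independent (G : sgraph) (S : {set G}) : bool :=
  [forall x in S, forall y in S, ~~ edge x y].

Definition alpha (G : sgraph) : nat :=
  \max_(S : {set G} | independent S) #|S|.

(* A subgraph is a pair (vertex set, edge set); edges are unordered pairs, so a
   path and its reversal are one and the same subgraph. *)
Definition subgraph (G : sgraph) : finType :=
  ({set G} * {set {set G}})%type.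

Definition induced_subgraph (G : sgraph) (A : {set G}) : subgraph G :=
  (A, [set [set x; y] | x in A, y in A & edge x y]).

(* The subgraph formed by the walk x :: s. *)
Definition walk_subgraph (G : sgraph) (x : G) (s : seq G) : subgraph G :=
  ([set z in x :: s], [set [set p.1; p.2] | p in zip (x :: s) s]).

(* Bounding the size of s by the number of edges of P makes this a boolean and
   is harmless: see path_betweenP. *)
Definition path_between (G : sgraph) (x y : G) (P : subgraph G) : bool :=
  [exists s : #|P.2|.-tuple G,
    [&& path (@edge G) x s, uniq (x :: s), last x s == y
      & P == walk_subgraph x s]].

Definition is_path (G : sgraph) (P : subgraph G) : bool :=
  [exists x : G, exists y : G, path_between x y P].

Definition induced_path (G : sgraph) (P : subgraph G) : bool :=
  is_path P && (induced_subgraph P.1 == P).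

Definition isometric_path (G : sgraph) (P : subgraph G) : bool :=
  [exists x : G, exists y : G,
    path_between x y P &&
    [forall Q : subgraph G, path_between x y Q ==> (#|P.2| <= #|Q.2|)]].

Definition path_cover (G : sgraph) (kind : pred (subgraph G))
    (C : {set subgraph G}) : bool :=
  [forall P in C, kind P] && [forall x : G, exists P in C, x \in P.1].

Definition path_partition (G : sgraph) (kind : pred (subgraph G))
    (C : {set subgraph G}) : bool :=
  [forall P in C, kind P] &&
  [forall x : G, #|[set P in C | x \in P.1]| == 1].

Definition has_card (T : finType) (F : pred {set T}) : pred nat :=
  fun n => [exists C : {set T}, F C && (#|C| == n)].

Lemma card_walk_edges (G : sgraph) (x : G) (s : seq G) :
  uniq (x :: s) -> #|(walk_subgraph x s).2| = size s.
Proof.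
elim: s x => [|y s IHs] x.
  by move=> _; apply/eqP; rewrite cards_eq0; apply/eqP/setP=> A;
     rewrite inE; apply/imsetP=> -[p].
move=> /= /andP[xNys uys].
have -> : [set [set p.1; p.2] | p in (x, y) :: zip (y :: s) s] =
          [set x; y] |: (walk_subgraph y s).2.
  apply/setP=> A; rewrite in_setU1; apply/imsetP/orP => [[p]|].
    rewrite inE => /orP[/eqP -> ->|pin ->]; first by left.
    by right; apply: imset_f.
  case=> [/eqP ->|/imsetP[p pin ->]].
    by exists (x, y); rewrite ?inE ?eqxx.
  by exists p => //; rewrite inE pin orbT.
rewrite cardsU1 IHs // -[RHS]add1n; congr (_ + _).
suff -> : [set x; y] \notin (walk_subgraph y s).2 by [].
apply/imsetP=> -[[a b] /= abin Exy].
have /andP[ain bin] : (a \in y :: s) && (b \in y :: s).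
  have [i lti [-> ->]] : exists2 i, i < size s &
      (a, b) = (nth y (y :: s) i, nth y s i) :> (G * G).
    move/(nthP (y, y)): abin => -[i]; rewrite size_zip /= => lti <-.
    have ltis : i < size s by apply: leq_trans lti (geq_minr _ _).
    by exists i => //; rewrite nth_zip_cond size_zip /= lti.
  rewrite mem_nth /=; last by rewrite ltnS ltnW.
  by rewrite inE mem_nth ?orbT.
have : x \in [set a; b] by rewrite -Exy !inE eqxx.
by rewrite !inE => /orP[] /eqP Ex; move: xNys; rewrite Ex ?ain ?bin.
Qed.

Lemma path_betweenP (G : sgraph) (x y : G) (P : subgraph G) :
  reflect (exists s : seq G, [/\ path (@edge G) x s, uniq (x :: s),
                                 last x s = y & P = walk_subgraph x s])
          (path_between x y P).
Proof.
apply: (iffP existsP) => [[s /and4P[ps us /eqP ls /eqP EP]]|[s [ps us ls EP]]].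
  by exists s.
have size_s : size s == #|P.2| by rewrite EP card_walk_edges.
by exists (Tuple size_s); apply/and4P; split=> //; apply/eqP.
Qed.

Definition trivial_path (G : sgraph) (x : G) : subgraph G := walk_subgraph x [::].

Lemma trivial_path_vertices (G : sgraph) (x : G) : (trivial_path x).1 = [set x].
Proof. by apply/setP=> z; rewrite !inE. Qed.

Lemma trivial_path_edges (G : sgraph) (x : G) : (trivial_path x).2 = set0.
Proof. by apply/eqP; rewrite -cards_eq0 card_walk_edges. Qed.

Lemma trivial_path_between (G : sgraph) (x : G) :
  path_between x x (trivial_path x).
Proof. by apply/path_betweenP; exists [::]. Qed.

Lemma trivial_path_induced (G : sgraph) (x : G) : induced_path (trivial_path x).
Proof.
apply/andP; split.
  by apply/existsP; exists x; apply/existsP; exists x; apply: trivial_path_between.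
apply/eqP; rewrite [RHS]surjective_pairing trivial_path_edges.
congr pair; apply/setP=> A; rewrite [RHS]inE; apply/imset2P=> -[a b].
rewrite trivial_path_vertices !inE => /eqP -> /andP[/eqP ->].
by rewrite edge_irr.
Qed.

Lemma trivial_path_isometric (G : sgraph) (x : G) :
  isometric_path (trivial_path x).
Proof.
apply/existsP; exists x; apply/existsP; exists x.
rewrite trivial_path_between; apply/forallP=> Q; apply/implyP=> _.
by rewrite trivial_path_edges cards0.
Qed.

Definition trivial_paths (G : sgraph) : {set subgraph G} :=
  [set trivial_path x | x in G].

Lemma ex_path_partition (G : sgraph) (kind : pred (subgraph G)) :
  (forall x : G, kind (trivial_path x)) ->
  exists n, has_card (path_partition kind) n.
Proof.
move=> kind_trivial; exists #|trivial_paths G|; apply/existsP.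
exists (trivial_paths G); rewrite eqxx andbT.
apply/andP; split.
  by apply/forallP=> P; apply/implyP=> /imsetP[x _ ->].
apply/forallP=> x; apply/cards1P; exists (trivial_path x); apply/setP=> P.
rewrite !inE; apply/andP/eqP=> [[/imsetP[z _ ->]]|->].
  by rewrite trivial_path_vertices inE => /eqP ->.
by rewrite imset_f // trivial_path_vertices inE.
Qed.

Lemma ex_path_cover (G : sgraph) (kind : pred (subgraph G)) :
  (forall x : G, kind (trivial_path x)) ->
  exists n, has_card (path_cover kind) n.
Proof.
move=> kind_trivial; exists #|trivial_paths G|; apply/existsP.
exists (trivial_paths G); rewrite eqxx andbT.
apply/andP; split.
  by apply/forallP=> P; apply/implyP=> /imsetP[x _ ->].
apply/forallP=> x; apply/existsP; exists (trivial_path x).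
by rewrite trivial_path_vertices set11 andbT; apply: imset_f.
Qed.

Definition rho_c (G : sgraph) : nat :=
  ex_minn (ex_path_cover (@trivial_path_induced G)).
Definition rho_p (G : sgraph) : nat :=
  ex_minn (ex_path_partition (@trivial_path_induced G)).
Definition ip_c (G : sgraph) : nat :=
  ex_minn (ex_path_cover (@trivial_path_isometric G)).
Definition ip_p (G : sgraph) : nat :=
  ex_minn (ex_path_partition (@trivial_path_isometric G)).

(* Main.v *)
Require Import Defs.
From mathcomp Require Import all_boot.

(** Covering the vertices by edges and single vertices is enough: both are
    induced and isometric paths. That alpha(G) of them suffice is König's
    theorem, proved by induction on a vertex set [W]. If a maximum independent
    set S of [W] is none of the two colour classes A, B of [W], the sets
    (A \ S) u (B n S) and (B \ S) u (A n S) are smaller than [W] and have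
    independence numbers |B n S| and |A n S|. Otherwise every maximum
    independent set of [W] is a colour class, so deleting the ends of an edge
    lowers the independence number. *)

Set Implicit Arguments.
Unset Strict Implicit.
Unset Printing Implicit Defensive.

(** * Independent sets and set partitions *)

Lemma independentP (G : sgraph) (S : {set G}) :
  reflect {in S &, forall x y, ~~ edge x y} (independent S).
Proof.
apply: (iffP forall_inP) => [indS x y xS yS|indS x xS].
  by have /forall_inP := indS x xS; apply.
by apply/forall_inP=> y yS; apply: indS.
Qed.

Lemma independent_leq_alpha (G : sgraph) (S : {set G}) :
  independent S -> #|S| <= alpha G.
Proof. by move=> indS; apply: leq_bigmax_cond. Qed.

Lemma partition_disjointU (T : finType) (P Q : {set {set T}}) (D E : {set T}) :
  partition P D -> partition Q E -> [disjoint D & E] ->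
  partition (P :|: Q) (D :|: E).
Proof.
move=> /and3P[/eqP covP triP P0] /and3P[/eqP covQ triQ Q0] disDE.
have covPQ : cover (P :|: Q) = D :|: E.
  by rewrite /cover bigcup_setU -/(cover P) -/(cover Q) covP covQ.
rewrite /partition covPQ eqxx in_setU negb_or P0 Q0 !andbT /=.
have sub (R : {set {set T}}) (B : {set T}) : B \in R -> B \subset cover R by exact: bigcup_sup.
apply/trivIsetP=> B C; rewrite !in_setU.
case/orP=> BR /orP[] CR neqBC.
- exact: (trivIsetP triP).
- by apply: disjointW disDE; rewrite -?covP -?covQ; apply: sub.
- rewrite disjoint_sym.
  by apply: disjointW disDE; rewrite -?covP -?covQ; apply: sub.
- exact: (trivIsetP triQ).
Qed.

Definition vertex_or_edge (G : sgraph) (B : {set G}) : Prop :=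
  (exists x, B = [set x]) \/ (exists x y, edge x y /\ B = [set x; y]).

Lemma partition_singletons (T : finType) (D : {set T}) :
  partition [set [set x] | x in D] D.
Proof.
apply/and3P; split.
- apply/eqP; rewrite cover_imset; apply/setP=> x.
  by apply/bigcupP/idP=> [[y yD /set1P->]|xD] //; exists x; rewrite ?set11.
- apply/trivIsetP=> _ _ /imsetP[x _ ->] /imsetP[y _ ->] neq.
  by rewrite disjoints1 inE; apply: contraNneq neq => ->.
- by apply/imsetP=> -[x _ /setP/(_ x)]; rewrite !inE eqxx.
Qed.

(** * Exchanging colour classes along an independent set *)

Definition bicoloring (G : sgraph) (A : {set G}) : Prop :=
  forall x y : G, edge x y -> (x \in A) != (y \in A).

Lemma bicoloringC (G : sgraph) (A : {set G}) : bicoloring A -> bicoloring (~: A).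
Proof. by move=> bipA x y /bipA; rewrite !inE (inj_eq negb_inj). Qed.

(** With the colour class [A] as a parameter, the second part is the instance at [~: A], so each
    fact is proved for one part only. *)
Definition exchange_part (T : finType) (A W S : {set T}) : {set T} :=
  ((W :&: A) :\: S) :|: (S :\: A).

Lemma exchange_partU (T : finType) (A W S : {set T}) : S \subset W ->
  exchange_part A W S :|: exchange_part (~: A) W S = W.
Proof.
move/subsetP=> SW; apply/setP=> x; rewrite !inE; have := SW x.
by case: (x \in S); case: (x \in A); case: (x \in W) => // /(_ isT).
Qed.

Lemma exchange_part_disjoint (T : finType) (A W S : {set T}) :
  [disjoint exchange_part A W S & exchange_part (~: A) W S].
Proof.
rewrite -setI_eq0; apply/eqP/setP=> x; rewrite !inE.
by case: (x \in S); case: (x \in A); case: (x \in W).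
Qed.

Lemma exchange_part_sub (T : finType) (A W S : {set T}) :
  S \subset W -> exchange_part A W S \subset W.
Proof.
move=> SW; apply: subset_trans (_ : _ \subset _ :|: exchange_part (~: A) W S) _.
  exact: subsetUl.
by rewrite exchange_partU.
Qed.

(** The part omits S n A and the vertices of W \ A outside [S]. If both sets are empty, [S] is the
    class W \ A. *)
Lemma exchange_part_proper (T : finType) (A W S : {set T}) : S \subset W ->
  S != W :\: A -> exchange_part A W S \proper W.
Proof.
move=> SW neqS; rewrite properEneq exchange_part_sub // andbT.
apply: contraNneq neqS => eqW; apply/eqP/setP=> x.
move/subsetP/(_ x): SW; move/setP/(_ x): eqW; rewrite !inE.
by case: (x \in S); case: (x \in A); case: (x \in W) => //= _ /(_ isT).
Qed.

(* A larger independent set X of the exchange part could be completed by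
   S n A to an independent set of W larger than S. *)
Lemma exchange_part_bound (G : sgraph) (A W S X : {set G}) :
  bicoloring A -> S \subset W -> independent S ->
  (forall Y : {set G}, Y \subset W -> independent Y -> #|Y| <= #|S|) ->
  X \subset exchange_part A W S -> independent X -> #|X| <= #|S :\: A|.
Proof.
move=> bipA SW indS maxS XD indX.
have cross x y : x \in X -> y \in S :&: A -> ~~ edge x y.
  move=> xX /setIP[yS yA]; have [xS|xNS] := boolP (x \in S).
    exact: (independentP _ indS).
  (* Outside [S], the exchange part lies in [A], so [x] and [y] have the same colour. *)
  have := subsetP XD x xX; rewrite !inE (negPf xNS) andbF orbF => /and3P[_ _ xA].
  by apply/negP=> /bipA; rewrite xA yA.
have disXS : X :&: (S :&: A) = set0.
  apply/setP=> x; rewrite [RHS]inE; apply/setIP=> -[/(subsetP XD)].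
  by rewrite !inE => /orP[/andP[/negP xNS _]|/andP[/negP xNA _]] /andP[].
have : #|X :|: (S :&: A)| <= #|S|.
  apply: maxS.
    rewrite subUset (subset_trans (subsetIl _ _) SW) andbT.
    exact: subset_trans XD (exchange_part_sub A SW).
  apply/independentP=> x y /setUP[xX|xS] /setUP[yX|yS].
  - exact: (independentP _ indX).
  - exact: cross.
  - by rewrite edge_sym; apply: cross.
  - move: xS yS => /setIP[xS _] /setIP[yS _].
    exact: (independentP _ indS).
by rewrite cardsU disXS cards0 subn0 -(cardsID A S) addnC leq_add2l.
Qed.

(** Here [k] is any upper bound, attained or not, so the induction hypothesis needs only a bound on
    the smaller set. If [k] is not attained, no exchange takes place and the argument by deletion
    still applies. *)
Lemma konig_partition (G : sgraph) (A W : {set G}) (k : nat) :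
  bicoloring A ->
  (forall S : {set G}, S \subset W -> independent S -> #|S| <= k) ->
  exists P : {set {set G}}, [/\ partition P W, #|P| <= k &
    {in P, forall B, vertex_or_edge B}].
Proof.
move=> bipA; move: {2}#|W|.+1 (ltnSn #|W|) => n.
elim: n W k => // n IHn W k leWn leSk.
have [/existsP[S /and5P[SW indS /eqP cS SA SB]]|noS] := boolP [exists S : {set G},
    [&& S \subset W, independent S, #|S| == k, S != W :&: A & S != W :\: A]].
  rewrite -[A in W :&: A]setCK -setDE in SA.
  (* The bound now says that [S] is a maximum independent set of [W], as the bound on the exchange
     parts requires. *)
  rewrite -cS in leSk.
  have small A' : S != W :\: A' -> #|exchange_part A' W S| < n.
    move=> neqS; apply: leq_trans (proper_card (exchange_part_proper SW neqS)) _.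
    by rewrite -ltnS.
  have [P [parP leP voeP]] := IHn _ _ (small _ SB)
    (fun X => exchange_part_bound bipA SW indS leSk).
  have [Q [parQ leQ voeQ]] := IHn _ _ (small _ SA)
    (fun X => exchange_part_bound (bicoloringC bipA) SW indS leSk).
  exists (P :|: Q); split.
  - rewrite -(exchange_partU A SW); apply: partition_disjointU => //.
    exact: exchange_part_disjoint.
  (* The two bounds add up: |S \ A| + |S n A| = |S| = k. *)
  - apply: leq_trans (leq_card_setU _ _) _.
    rewrite -cS -(cardsID A S) addnC; apply: leq_add => //.
    by rewrite setDE setCK in leQ.
  - by move=> B /setUP[/voeP|/voeQ].
have [indW|] := boolP (independent W).
  exists [set [set x] | x in W]; split.
  - exact: partition_singletons.
  - exact: leq_trans (leq_imset_card _ _) (leSk W (subxx W) indW).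
  - by move=> _ /imsetP[x _ ->]; left; exists x.
move=> /forall_inPn[u uW /forall_inPn[v vW]]; rewrite negbK => euv.
have uvW : [set u; v] \subset W by rewrite subUset !sub1set uW vW.
have card_uv : 0 < #|[set u; v]| by apply/card_gt0P; exists u; rewrite set21.
have k_gt0 : 0 < k.
  rewrite -(cards1 u); apply: leSk; first by rewrite sub1set.
  by apply/independentP=> x y /set1P-> /set1P->; rewrite edge_irr.
(* From here on the bound for [W] is [k.+1], and [k] has to work once [u] and [v] are deleted. *)
case: k k_gt0 leSk noS => // k _ leSk noS.
have leSk' (S : {set G}) : S \subset W :\: [set u; v] -> independent S -> #|S| <= k.
  rewrite subsetD => /andP[SW disS] indS.
  (* An independent set of size [k.+1] that avoids [u] and [v] is no colour class of [W], since each
     class contains one end of the edge; [noS] excludes such a set. *)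
  rewrite leqNgt; apply: contra noS => ltkS; apply/existsP; exists S.
  have notin z : z \in [set u; v] -> z \notin S.
    by move=> zuv; rewrite (disjointFl disS zuv).
  rewrite SW indS eqn_leq leSk //= ltkS /=.
  have := bipA _ _ euv; have := notin u (set21 u v); have := notin v (set22 u v).
  move=> vS uS uvA; apply/andP; split; apply/eqP=> defS; move: vS uS uvA;
  by rewrite defS !inE uW vW /= ?andbT; case: (u \in A); case: (v \in A).
have ltn : #|W :\: [set u; v]| < n.
  rewrite -ltnS; apply: leq_trans leWn; rewrite ltnS -(cardsID [set u; v] W).
  by rewrite (setIidPr uvW) -add1n leq_add2r.
have [P [parP leP voeP]] := IHn _ _ ltn leSk'.
exists ([set u; v] |: P); split.
- rewrite -(setID W [set u; v]) (setIidPr uvW).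
  apply: partitionU1 => //; first by rewrite -card_gt0.
  by rewrite disjoint_sym disjoints_subset setDE subsetIr.
- by apply: leq_trans (leq_card_setU _ _) _; rewrite cards1 add1n ltnS.
- move=> B /setU1P[->|/voeP //].
  by right; exists u, v.
Qed.

(** * Vertices and edges as paths *)

Lemma induced_subgraph1 (G : sgraph) (x : G) :
  induced_subgraph [set x] = trivial_path x.
Proof.
by have /andP[_ /eqP] := trivial_path_induced x; rewrite trivial_path_vertices.
Qed.

Lemma induced_subgraph_edge (G : sgraph) (x y : G) :
  edge x y -> induced_subgraph [set x; y] = walk_subgraph x [:: y].
Proof.
move=> exy; congr pair; first by apply/setP=> z; rewrite !inE.
apply/setP=> B; apply/imset2P/imsetP=> [[a b]|[p]].
  rewrite !inE => /orP[]/eqP-> /andP[/orP[]/eqP->]; rewrite ?edge_irr // => _ ->;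
  by exists (x, y); rewrite ?inE //= setUC.
by rewrite inE => /eqP-> ->; exists x y; rewrite ?inE ?eqxx ?orbT.
Qed.

Lemma path_between_edge (G : sgraph) (x y : G) :
  edge x y -> path_between x y (induced_subgraph [set x; y]).
Proof.
move=> exy; apply/path_betweenP; exists [:: y].
rewrite induced_subgraph_edge //; split=> //=; rewrite ?exy // inE andbT.
by apply: contraTneq exy => ->; rewrite edge_irr.
Qed.

Lemma vertex_or_edge_induced (G : sgraph) (B : {set G}) :
  vertex_or_edge B -> induced_path (induced_subgraph B).
Proof.
case=> [[x ->]|[x [y [exy ->]]]].
  by rewrite induced_subgraph1 trivial_path_induced.
rewrite /induced_path eqxx andbT; apply/existsP; exists x.
by apply/existsP; exists y; apply: path_between_edge.
Qed.

Lemma vertex_or_edge_isometric (G : sgraph) (B : {set G}) :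
  vertex_or_edge B -> isometric_path (induced_subgraph B).
Proof.
case=> [[x ->]|[x [y [exy ->]]]].
  by rewrite induced_subgraph1 trivial_path_isometric.
apply/existsP; exists x; apply/existsP; exists y.
rewrite path_between_edge // andTb.
apply/forall_inP=> Q /path_betweenP[s [_ us ls ->]].
rewrite induced_subgraph_edge // (card_walk_edges us) card_walk_edges /=.
  (* A competing path without edges would force [x = y], making the edge a loop. *)
  by case: s ls {us} => //= eqxy; rewrite eqxy edge_irr in exy.
by rewrite inE andbT; apply: contraTneq exy => ->; rewrite edge_irr.
Qed.

(** The vertex set of [induced_subgraph B] is [B] itself, so the only path through [x] is the one on
    its block [pblock P x]. *)
Lemma path_partition_induced_subgraphs (G : sgraph) (kind : pred (subgraph G))
    (P : {set {set G}}) :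
  partition P setT -> {in P, forall B, kind (induced_subgraph B)} ->
  path_partition kind [set induced_subgraph B | B in P].
Proof.
move=> /and3P[/eqP covP triP _] kindP; apply/andP; split.
  by apply/forall_inP=> _ /imsetP[B BP ->]; apply: kindP.
apply/forallP=> x; apply/cards1P; exists (induced_subgraph (pblock P x)).
have xP : x \in cover P by rewrite covP.
apply/setP=> Q; rewrite !inE; apply/andP/eqP=> [[/imsetP[B BP ->] xB]|->].
  by rewrite (def_pblock triP BP xB).
by rewrite imset_f ?pblock_mem //= mem_pblock.
Qed.

(** Leaving [kind] open lets the same argument serve induced and isometric paths. *)
Lemma bipartite_path_partition (G : sgraph) (kind : pred (subgraph G)) :
  bipartite G ->
  (forall B : {set G}, vertex_or_edge B -> kind (induced_subgraph B)) ->
  exists2 C, path_partition kind C & #|C| <= alpha G.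
Proof.
move=> [A bipA] kindP.
have [P [parP leP voeP]] := @konig_partition G A setT (alpha G) bipA
  (fun S _ => @independent_leq_alpha G S).
exists [set induced_subgraph B | B in P].
  by apply: path_partition_induced_subgraphs => // B /voeP/kindP.
exact: leq_trans (leq_imset_card _ _) leP.
Qed.

(** * Comparing the minima *)

Lemma path_partition_cover (G : sgraph) (kind : pred (subgraph G)) C :
  path_partition kind C -> path_cover kind C.
Proof.
move=> /andP[kindC /forallP partC]; rewrite /path_cover kindC /=.
apply/forallP=> x; have /cards1P[Q /setP/(_ Q)] := partC x.
by rewrite !inE eqxx => CQ; apply/existsP; exists Q.
Qed.

Lemma min_card_leq (T : finType) (F : pred {set T}) (exF : exists n, has_card F n)
  (C : {set T}) : F C -> ex_minn exF <= #|C|.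
Proof.
move=> FC; case: ex_minnP => m _; apply.
by apply/existsP; exists C; rewrite FC eqxx.
Qed.

(** A smallest family satisfying [F] competes in the minimum for [F']. *)
Lemma min_card_subpred (T : finType) (F F' : pred {set T})
    (exF : exists n, has_card F n) (exF' : exists n, has_card F' n) :
  (forall C, F C -> F' C) -> ex_minn exF' <= ex_minn exF.
Proof.
move=> FF'; case: (ex_minnP exF) => m /existsP[C /andP[FC /eqP <-]] _.
exact/min_card_leq/FF'.
Qed.

Theorem theorem4p4 (G : sgraph) :
  connected G -> bipartite G ->
  (rho_c G <= rho_p G <= alpha G) /\ (ip_c G <= ip_p G <= alpha G).
Proof.
move=> _ bipG.
have [C partC leC] := bipartite_path_partition bipG (@vertex_or_edge_induced G).
have [D partD leD] := bipartite_path_partition bipG (@vertex_or_edge_isometric G).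
split; apply/andP; split.
- exact/min_card_subpred/path_partition_cover.
- exact: leq_trans (min_card_leq _ partC) leC.
- exact/min_card_subpred/path_partition_cover.
- exact: leq_trans (min_card_leq _ partD) leD.
Qed.
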